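(* If $s \in (0,1)$, then there is a constant $C>0$ (which may depend on $s$) such that $$\int_0^{\infty} t\, \mathrm{Cap}_s(\{x\in I_0 : f(x)\geq t\}) \, dt \le C\, \|f\|_{H^s}^2$$ for every $f \in H^s$.
   Context: All functions are real-valued and defined on $I_0=[0,1]$; $L^2=L^2([0,1])$; $(f,g)=\int_{I_0} f(x)g(x)\,dx$. Dyadic system: $\mathcal D=\{2^{-j}([0,1)+k): j=0,1,2,\dots,\ k=0,\dots,2^j-1\}$. For $I\in\mathcal D$, $I_-,I_+$ are its left and right halves, and $h_I=|I|^{-1/2}(\mathbb 1_{I_-}-\mathbb 1_{I_+})$. Local dyadic fractional Sobolev space: $D^sf=\sum_{I\in\mathcal D}|I|^{-s}(f,h_I)h_I$, and $H^s$ is the set of $f\in L^2$ with $\|f\|_{H^s}^2:=\|D^sf\|_{L^2}^2+\|f\|_{L^2}^2<\infty$, where $\|D^sf\|_{L^2}^2=\sum_{I\in\mathcal D}|I|^{-2s}|(f,h_I)|^2$. Dyadic Sobolev $s$-capacity: for $E\subseteq I_0$, $\mathrm{Cap}_s(E)=\inf\{\|f\|_{H^s}^2: f\in H^s,\ f\ge 1 \text{ a.e. on } E\}$ (equal to $\infty$ if no such $f$ exists). *)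

(* Defs.v *)
From HB Require Import structures.
From mathcomp Require Import all_boot all_order all_algebra.
From mathcomp Require Import all_classical all_reals all_analysis.
Set Implicit Arguments.
Unset Strict Implicit.
Unset Printing Implicit Defensive.
Import Order.TTheory GRing.Theory Num.Theory numFieldNormedType.Exports.
Local Open Scope classical_set_scope.
Local Open Scope ring_scope.

(* Functions on [0, 1] are represented by functions R -> R of which only the
   values on [0, 1] are used. *)
Definition I0 (R : realType) : set R := [set` `[0 : R, 1]].
Arguments I0 {R}.

Definition is_L2 (R : realType) (f : R -> R) : Prop :=
  f \_ I0 \in Lfun (@lebesgue_measure R) 2%:E.

Definition ip (R : realType) (f g : R -> R) : R :=
  \int[@lebesgue_measure R]_(x in I0) (f x * g x).

Definition sqnorm_L2 (R : realType) (f : R -> R) : \bar R :=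
  (\int[@lebesgue_measure R]_(x in I0) ((f x) ^+ 2)%:E)%E.

(* The dyadic interval 2^-j ([0, 1) + k); it is contained in [0, 1] when
   k < 2 ^ j. Its left and right halves are dyadic R j.+1 k.*2 and
   dyadic R j.+1 k.*2.+1. *)
Definition dyadic (R : realType) (j k : nat) : set R :=
  [set` `[2 ^- j * k%:R : R, 2 ^- j * k.+1%:R[].
Arguments dyadic R j k : clear implicits.

(* The length of dyadic R j k. *)
Definition dlen (R : realType) (j : nat) : R := 2 ^- j.
Arguments dlen R j : clear implicits.

Definition haar (R : realType) (j k : nat) (x : R) : R :=
  dlen R j `^ (- 2^-1) *
  (\1_(dyadic R j.+1 k.*2) x - \1_(dyadic R j.+1 k.*2.+1) x).

(* || D^s f ||^2 in L^2, computed by orthonormality of the Haar functions: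
   the sum over the dyadic intervals I of |I|^(-2s) |(f, h_I)|^2. *)
Definition sqnorm_D (R : realType) (s : R) (f : R -> R) : \bar R :=
  (\sum_(0 <= j <oo)
     (\sum_(k < 2 ^ j)
        dlen R j `^ (- (2 * s)) * `|ip f (haar j k)| ^+ 2)%R%:E)%E.

Definition sqnorm_H (R : realType) (s : R) (f : R -> R) : \bar R :=
  (sqnorm_D s f + sqnorm_L2 f)%E.

Definition is_H (R : realType) (s : R) (f : R -> R) : Prop :=
  is_L2 f /\ (sqnorm_H s f < +oo)%E.

(* ereal_inf set0 = +oo, as required when E has no admissible function. *)
Definition Cap (R : realType) (s : R) (E : set R) : \bar R :=
  ereal_inf [set sqnorm_H s f | f in
    [set f : R -> R | is_H s f /\
       {ae @lebesgue_measure R, forall x, E x -> 1 <= f x}]].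

(* Main.v *)
Require Import Defs.
From HB Require Import structures.
From mathcomp Require Import all_boot all_order all_algebra.
From mathcomp Require Import all_classical all_reals all_analysis.
From mathcomp Require Import measurable_realfun ring lra.
Import Order.TTheory GRing.Theory Num.Theory numFieldNormedType.Exports.
Local Open Scope classical_set_scope.
Local Open Scope ring_scope.

(** The proof is a truncation argument. Cut [f] at the heights [c_j = 2 ^ j * b];
    the slice [phi_j = clip c_(j+1) f - clip c_j f] is a nondecreasing function
    of [f] that equals [c_j] where [f >= c_(j+1)], so [phi_j / c_j] is admissible
    for the capacity of that superlevel set and
    [c_j ^ 2 * Cap {f >= c_(j+1)} <= ||phi_j||^2] (lemma [Cap_chebyshev]). As the
    capacity of a superlevel set decreases with the height, the integral of
    [t * Cap {f >= t}] over [[c_(j+1), c_(j+2))] is at most [8 * ||phi_j||^2].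
    What remains is that the slices do not cost more than [f] itself,
    [sum_j ||phi_j||^2 <= ||f||^2] (lemma [sum_sqnorm_H_clip]). Hence [8] is a
    suitable constant.

    That inequality holds because the squared Sobolev norm is a Dirichlet form.
    Let [m_j f] be the squared norm of the projection of [f] onto the functions
    constant on the dyadic intervals of generation [j]. The Haar coefficients of
    generation [j] have sum of squares [m_(j+1) f - m_j f] (lemma [haar_level]).
    Summation by parts, together with the convergence of [m_j f] to the integral
    of [f ^ 2], turns the energy into
    [sum_j w_j * osc_j f] with weights [w_j >= 0] and
    [osc_j f = int f ^ 2 - m_j f] (lemma [sqnorm_DE]). On each dyadic interval
    [osc_j] is a multiple of a variance, and for two functions [g], [h] that
    vary in the same direction the covariance is nonnegative by Chebyshev's
    inequality (lemma [comonotone_cov]); hence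
    [osc_j g + osc_j h <= osc_j (g + h)], and the squared norm is superadditive
    on such pairs (lemma [sqnorm_H_superadd]). Slices of the same [f] are
    comonotone, so the slices can be added one at a time.

    The convergence of [m_j f] is where analysis enters: dyadic averages
    converge almost everywhere by Lebesgue's differentiation theorem, and
    Fatou's lemma gives [int f ^ 2 <= liminf m_j f] (lemma [sqnorm_le_proj]). *)

Section StrongTypeInequality.
Set Implicit Arguments.
Unset Strict Implicit.
Unset Printing Implicit Defensive.
Context {R : realType}.
Notation mu := (@lebesgue_measure R).
(* The measurable structure over which [mu] is declared; it is only convertible
   to the default one on [R], so it is named explicitly where needed. *)
Notation RT := (measurableTypeR R).
Implicit Types (f g h : RT -> R) (D : set RT) (s : R) (j k n : nat).

(** * Square-integrable functions on the unit interval *)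

Lemma measurable_I0 : @measurable _ RT I0.
Proof. exact: measurable_itv. Qed.

Lemma I0_fin : (mu (@I0 R) < +oo)%E.
Proof. by rewrite /I0 lebesgue_measure_itv/= lte_fin ltr01 oppr0 addr0 ltry. Qed.

Lemma integrable_cst D (r : R) : measurable D -> (mu D < +oo)%E ->
  mu.-integrable D (EFin \o (fun=> r)).
Proof.
move=> mD Dfin; apply/integrableP; split; first exact: measurable_cst.
by rewrite integral_cst// lte_mul_pinfty.
Qed.

(** Separates the two facts packed in the vanishing extension to the line, so that
    integration theory on [I0] applies directly. *)
Lemma is_L2P f : is_L2 f <->
  @measurable_fun _ _ RT R I0 f /\ mu.-integrable I0 (fun x => (f x ^+ 2)%:E).
Proof.
have mI := measurable_I0.
have sqE : (fun x => ((f \_ I0) x ^+ 2)%:E) = (fun x => (f x ^+ 2)%:E) \_ I0.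
  apply/funext => x; rewrite !patchE; case: ifPn => //= _.
  by rewrite expr0n.
rewrite /is_L2; split => [fL|[mf intf]].
- split.
    apply/(measurable_restrictT _ _).2 => //.
    by move: fL; rewrite inE => /andP[]; rewrite inE.
  have := @Lfun2_integrable_sqr _ _ _ mu _ fL.
  rewrite /comp sqE => h.
  exact: ((integrable_mkcond _ mI).2 h).
- have mF : measurable_fun setT (f \_ I0) by apply/(measurable_restrictT _ _).1.
  rewrite inE; apply/andP; split; rewrite inE//=.
  rewrite /finite_norm unlock; apply: poweR_lty.
  have -> : (fun x => (`|(EFin \o (f \_ I0)) x| `^ 2)%E) =
            (fun x => ((f \_ I0) x ^+ 2)%:E).
    apply/funext => x /=; rewrite powR_mulrn// -normrX ger0_norm//.
    exact: sqr_ge0.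
  rewrite sqE -integral_mkcond.
  case/integrableP : intf => _; apply: le_lt_trans.
  rewrite ge0_le_integral//.
  + by move=> x _; rewrite lee_fin sqr_ge0.
  + by apply/measurable_EFinP; exact: measurable_funX.
  + by apply: measurableT_comp => //; apply/measurable_EFinP; exact: measurable_funX.
  + by move=> x _; rewrite lee_fin ler_norm.
Qed.

Lemma L2_measurable f : is_L2 f -> @measurable_fun _ _ RT R I0 f.
Proof. by case/is_L2P. Qed.

Lemma L2_sqr f : is_L2 f -> mu.-integrable I0 (EFin \o (fun x => f x ^+ 2)).
Proof. by case/is_L2P. Qed.

Lemma L2_mul f g : is_L2 f -> is_L2 g ->
  mu.-integrable I0 (EFin \o (fun x => f x * g x)).
Proof.
move=> fL gL; have mI := measurable_I0.
have mf := L2_measurable fL; have mg := L2_measurable gL.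
apply: (le_integrable mI _ _ (integrableD mI (L2_sqr fL) (L2_sqr gL))).
- by apply/measurable_EFinP; exact: measurable_funM.
- move=> x _ /=; rewrite lee_fin ler_norml ler_normr.
  have := sqr_ge0 (f x - g x); have := sqr_ge0 (f x + g x).
  have := sqr_ge0 (f x); have := sqr_ge0 (g x).
  rewrite sqrrB sqrrD => *; apply/andP; split; last by apply/orP; left; nra.
  by rewrite ger0_norm; nra.
Qed.

Lemma L2_cst (r : R) : is_L2 (fun=> r).
Proof.
apply/is_L2P; split; first exact: measurable_cst.
exact: integrable_cst measurable_I0 I0_fin.
Qed.

Lemma L2_integrable f : is_L2 f -> mu.-integrable I0 (EFin \o f).
Proof.
move=> fL; have := L2_mul fL (L2_cst 1).
by under eq_fun do rewrite mulr1.
Qed.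

Lemma L2_le f g : @measurable_fun _ _ RT R I0 f -> is_L2 g ->
  (forall x, I0 x -> `|f x| <= `|g x|) -> is_L2 f.
Proof.
move=> mf gL fg; apply/is_L2P; split => //.
apply: (le_integrable measurable_I0 _ _ (L2_sqr gL)).
  by apply/measurable_EFinP; exact: measurable_funX.
move=> x Ix /=; rewrite lee_fin !normrX lerXn2r ?nnegrE//.
exact: fg.
Qed.

Lemma L2_scale f (r : R) : is_L2 f -> is_L2 (fun x => r * f x).
Proof.
move=> fL; apply/is_L2P; split.
  by apply: measurable_funM => //; exact: L2_measurable.
have := integrableZl measurable_I0 (r ^+ 2) (L2_sqr fL).
by apply: eq_integrable; [exact: measurable_I0 | move=> x _ /=; rewrite exprMn EFinM].
Qed.

Lemma L2_add f g : is_L2 f -> is_L2 g -> is_L2 (fun x => f x + g x).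
Proof.
move=> fL gL; have mI := measurable_I0; apply/is_L2P; split.
  by apply: measurable_funD; exact: L2_measurable.
have := integrableD mI (integrableD mI (L2_sqr fL) (L2_sqr gL))
   (integrableZl mI 2 (L2_mul fL gL)).
apply: eq_integrable; first exact: measurable_I0.
by move=> x _ /=; rewrite -EFinD; congr EFin; ring.
Qed.

Lemma sqnorm_L2E f : is_L2 f ->
  sqnorm_L2 f = (\int[mu]_(x in I0) (f x ^+ 2))%:E.
Proof.
move=> fL; rewrite /sqnorm_L2 /Rintegral fineK//.
exact: (integrable_fin_num measurable_I0 (L2_sqr fL)).
Qed.

(** Chebyshev's inequality: integrating
    [(g x - g y) * (h x - h y) >= 0] first in [x] and then in [y] gives
    [2 * (|D| * int gh - int g * int h) >= 0]. Each step uses only the linearity of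
    a simple integral. With [h = g] it is the Cauchy-Schwarz bound for the mean. *)
Lemma comonotone_cov D g h : measurable D -> (mu D < +oo)%E ->
  mu.-integrable D (EFin \o g) -> mu.-integrable D (EFin \o h) ->
  mu.-integrable D (EFin \o (fun x => g x * h x)) ->
  (forall x y, D x -> D y -> 0 <= (g x - g y) * (h x - h y)) ->
  (\int[mu]_(x in D) g x) * (\int[mu]_(x in D) h x) <=
  fine (mu D) * \int[mu]_(x in D) (g x * h x).
Proof.
move=> mD Dfin ig ih igh co.
set G := \int[mu]_(x in D) g x; set H := \int[mu]_(x in D) h x.
set P := \int[mu]_(x in D) (g x * h x).
have icst (r : R) : mu.-integrable D (EFin \o (fun=> r)) by exact: integrable_cst.
have iZ u (r : R) : mu.-integrable D (EFin \o u) ->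
    mu.-integrable D (EFin \o (fun x => r * u x)).
  by move=> iu; have := integrableZl mD r iu.
have iD u v : mu.-integrable D (EFin \o u) -> mu.-integrable D (EFin \o v) ->
    mu.-integrable D (EFin \o (fun x => u x + v x)).
  by move=> iu iv; have := integrableD mD iu iv.
(* The integral in [x] for fixed [y], expanded. *)
have inner y : D y ->
    0 <= P + ((- h y) * G + ((- g y) * H + g y * h y * fine (mu D))).
  move=> Dy.
  suff -> : P + ((- h y) * G + ((- g y) * H + g y * h y * fine (mu D))) =
      \int[mu]_(x in D) ((g x - g y) * (h x - h y)).
    by apply: Rintegral_ge0 => x Dx; exact: co.
  have i1 := icst (g y * h y); have i2 := iZ _ (- g y) ih.
  have i3 := iZ _ (- h y) ig; have i21 := iD _ _ i2 i1.
  rewrite -(Rintegral_cst mu mD) -!RintegralZl// -!RintegralD//; last exact: iD.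
  by apply: eq_Rintegral => x _; ring.
(* The expanded expression is integrated in [y]. *)
have : 0 <= \int[mu]_(y in D)
    (P + ((- G) * h y + ((- H) * g y + fine (mu D) * (g y * h y)))).
  apply: Rintegral_ge0 => y /inner.
  by congr (0 <= _); ring.
have i1 := iZ _ (fine (mu D)) igh.
have i2 := iD _ _ (iZ _ (- H) ig) i1.
have i3 := iD _ _ (iZ _ (- G) ih) i2.
rewrite RintegralD// RintegralD//; last exact: iZ.
rewrite RintegralD//; last exact: iZ.
rewrite !RintegralZl// Rintegral_cst// -/G -/H -/P.
move: (fine _) => d; nra.
Qed.

(** * Dyadic averages and oscillation *)

Lemma measurable_dyadic j k : @measurable _ RT (dyadic R j k).
Proof. exact: measurable_itv. Qed.

Lemma mu_dyadic j k : mu (dyadic R j k) = (2 ^- j)%:E.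
Proof.
have p : (0 : R) < 2 ^- j by rewrite invr_gt0 exprn_gt0.
rewrite /dyadic lebesgue_measure_itv/= lte_fin ltr_pM2l// ltr_nat ltnSn.
by rewrite -EFinB -mulrBr -natrB// subSnn mulr1.
Qed.

Lemma mu_dyadic_lty j k : (mu (dyadic R j k) < +oo)%E.
Proof. by rewrite mu_dyadic ltry. Qed.

Lemma dyadic_sub_I0 j k : (k < 2 ^ j)%N -> dyadic R j k `<=` I0.
Proof.
move=> kj x; rewrite /dyadic /I0 /= !in_itv/= => /andP[lx xr].
have p : (0 : R) < 2 ^- j by rewrite invr_gt0 exprn_gt0.
rewrite (le_trans _ lx) ?mulr_ge0 ?(ltW p)//=.
apply: (le_trans (ltW xr)).
by rewrite ler_pdivrMl ?exprn_gt0// mulr1 -natrX ler_nat.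
Qed.

Lemma dyadic_halves j k :
  dyadic R j k = dyadic R j.+1 k.*2 `|` dyadic R j.+1 k.*2.+1.
Proof.
have p : (0 : R) < 2 ^- j by rewrite invr_gt0 exprn_gt0.
have dbl n : n.*2%:R = 2 * n%:R :> R by rewrite -mul2n natrM.
have e0 : 2 ^- j.+1 * k.*2%:R = 2 ^- j * k%:R :> R.
  by rewrite dbl exprS invfM; field; rewrite expf_neq0.
have e2 : 2 ^- j.+1 * (k.*2.+2)%:R = 2 ^- j * k.+1%:R :> R.
  by rewrite -doubleS dbl exprS invfM; field; rewrite expf_neq0.
have e1 : 2 ^- j.+1 * (k.*2.+1)%:R = 2 ^- j * (k%:R + 2^-1) :> R.
  by rewrite -[k.*2.+1%:R]natr1 dbl exprS invfM; field; rewrite expf_neq0.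
rewrite /dyadic e0 e1 e2 -itv_bndbnd_setU// bnd_simp ler_pM2l//.
  by rewrite lerDl invr_ge0.
by rewrite -[k.+1%:R]natr1 lerD2l invf_le1// ler1n.
Qed.

Lemma dyadic_halves_disj j k :
  [disjoint dyadic R j.+1 k.*2 & dyadic R j.+1 k.*2.+1].
Proof.
apply/disj_setPS => x [] /=; rewrite /dyadic /= !in_itv/= => /andP[_ a] /andP[b _].
by move: (le_lt_trans b a); rewrite ltxx.
Qed.

Lemma sum_double (V : nmodType) (F : nat -> V) n :
  \sum_(k < n.*2) F k = \sum_(k < n) (F k.*2 + F k.*2.+1).
Proof.
elim: n => [|n IH]; first by rewrite !big_ord0.
by rewrite doubleS !big_ord_recr/= IH addrA.
Qed.

Lemma sum_dyadicS (V : nmodType) (F : nat -> V) j :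
  \sum_(k < 2 ^ j.+1) F k = \sum_(k < 2 ^ j) (F k.*2 + F k.*2.+1).
Proof. by rewrite expnS mul2n sum_double. Qed.

Lemma integrable_dyadic f j k : (k < 2 ^ j)%N ->
  mu.-integrable I0 (EFin \o f) -> mu.-integrable (dyadic R j k) (EFin \o f).
Proof.
move=> kj; apply: integrableS; [exact: measurable_I0|exact: measurable_dyadic|].
exact: dyadic_sub_I0.
Qed.

Lemma Rintegral_halves f j k : (k < 2 ^ j)%N ->
  mu.-integrable I0 (EFin \o f) ->
  \int[mu]_(x in dyadic R j k) f x =
  \int[mu]_(x in dyadic R j.+1 k.*2) f x +
  \int[mu]_(x in dyadic R j.+1 k.*2.+1) f x.
Proof.
move=> kj fi; rewrite dyadic_halves Rintegral_setU//.
- exact: measurable_dyadic.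
- exact: measurable_dyadic.
- by rewrite -dyadic_halves; exact: integrable_dyadic.
- exact: dyadic_halves_disj.
Qed.

Lemma Rintegral_dyadic f j : mu.-integrable I0 (EFin \o f) ->
  \int[mu]_(x in I0) f x = \sum_(k < 2 ^ j) \int[mu]_(x in dyadic R j k) f x.
Proof.
move=> fi; elim: j => [|j ->].
  rewrite big_ord_recr big_ord0 /= add0r /dyadic /I0 expr0 invr1 !mul1r.
  rewrite Rintegral_itv_bndo_bndc//.
  apply: integrableS fi; [exact: measurable_I0|exact: measurable_itv|].
  by apply: subset_itvl; rewrite bnd_simp.
rewrite (sum_dyadicS (fun k => \int[mu]_(x in dyadic R j.+1 k) f x)).
by apply: eq_bigr => k _; exact: Rintegral_halves.
Qed.

(** The squared norm of the orthogonal projection of [f] onto the functions that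
    are constant on the dyadic intervals of generation [j]: on such an interval [I]
    the projection has the value [|I|^-1 * int_I f]. *)
Definition proj_sqnorm j f : R :=
  \sum_(k < 2 ^ j) 2 ^+ j * (\int[mu]_(x in dyadic R j k) f x) ^+ 2.

(** The squared distance, in the L2 norm, of [f] from the functions constant on the
    dyadic intervals of generation [j]; equivalently
    [sum_I (2 |I|)^-1 int_I int_I (f x - f y) ^ 2 dx dy] over these intervals. *)
Definition oscillation j f : R :=
  \int[mu]_(x in I0) (f x ^+ 2) - proj_sqnorm j f.

Lemma ip_haar f j k : (k < 2 ^ j)%N -> is_L2 f ->
  `|ip f (haar j k)| ^+ 2 =
  2 ^+ j * (\int[mu]_(x in dyadic R j.+1 k.*2) f x -
            \int[mu]_(x in dyadic R j.+1 k.*2.+1) f x) ^+ 2.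
Proof.
move=> kj fL; have fi := L2_integrable fL.
have mD i l := measurable_dyadic i l.
have k1 : (k.*2 < 2 ^ j.+1)%N by rewrite expnS mul2n ltn_double.
have k2 : (k.*2.+1 < 2 ^ j.+1)%N by rewrite expnS mul2n ltn_Sdouble.
have icut l : (l < 2 ^ j.+1)%N ->
    mu.-integrable I0 (EFin \o (fun x => f x * \1_(dyadic R j.+1 l) x)).
  move=> lj; have := (integrable_restrict mu (mD j.+1 l) measurable_I0 (EFin \o f)).1.
  have -> : (EFin \o f) \_ (dyadic R j.+1 l) =
      EFin \o (fun x => f x * \1_(dyadic R j.+1 l) x).
    apply/funext => x; rewrite patchE /= indicE.
    by case: (x \in _); rewrite ?mulr1 ?mulr0.
  apply; apply: integrableS fi => //; first exact: measurable_I0.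
  by apply: measurableI => //; exact: measurable_I0.
have cut l : (l < 2 ^ j.+1)%N ->
    \int[mu]_(x in I0) (f x * \1_(dyadic R j.+1 l) x) =
    \int[mu]_(x in dyadic R j.+1 l) f x.
  move=> lj; rewrite -[in RHS](setIidr (dyadic_sub_I0 lj)) Rintegral_mkcondr.
  apply: eq_Rintegral => x _; rewrite patchE indicE.
  by case: (x \in _); rewrite ?mulr1 ?mulr0.
set c := dlen R j `^ (- 2^-1).
have -> : ip f (haar j k) = c *
    (\int[mu]_(x in dyadic R j.+1 k.*2) f x -
     \int[mu]_(x in dyadic R j.+1 k.*2.+1) f x).
  rewrite -!cut// -RintegralB//; [|exact: measurable_I0|exact: icut|exact: icut].
  rewrite -RintegralZl//; [|exact: measurable_I0|].
    by apply: eq_Rintegral => x _; rewrite /haar -/c; ring.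
  have := integrableB measurable_I0 (icut _ k1) (icut _ k2).
  by apply: eq_integrable; first exact: measurable_I0.
rewrite real_normK ?num_real// exprMn; congr (_ * _).
rewrite /c -powR_mulrn ?powR_ge0// -powRrM.
rewrite (_ : - 2^-1 * 2%:R = -1); last by field.
by rewrite powR_inv1 /dlen ?invrK// invr_ge0 exprn_ge0.
Qed.

(** With [A], [B] the integrals of [f] over the two halves of [I], this is the
    identity [2 (A ^ 2 + B ^ 2) - (A + B) ^ 2 = (A - B) ^ 2], divided by [|I|] and
    summed over the intervals of generation [j]. *)
Lemma haar_level f j : is_L2 f ->
  \sum_(k < 2 ^ j) `|ip f (haar j k)| ^+ 2 =
  proj_sqnorm j.+1 f - proj_sqnorm j f.
Proof.
move=> fL; rewrite /proj_sqnorm.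
rewrite (sum_dyadicS (fun k => 2 ^+ j.+1 * (\int[mu]_(x in dyadic R j.+1 k) f x) ^+ 2)).
rewrite -sumrB; apply: eq_bigr => k _.
rewrite ip_haar// (Rintegral_halves (ltn_ord k))//; last exact: L2_integrable.
by rewrite [2 ^+ j.+1]exprS; ring.
Qed.

Lemma oscillationE f j : is_L2 f -> oscillation j f =
  \sum_(k < 2 ^ j) (\int[mu]_(x in dyadic R j k) (f x ^+ 2) -
     2 ^+ j * (\int[mu]_(x in dyadic R j k) f x) ^+ 2).
Proof.
by move=> fL; rewrite /oscillation (Rintegral_dyadic j (L2_sqr fL)) -sumrB.
Qed.

Lemma comonotone_cov_dyadic g h j k : is_L2 g -> is_L2 h -> (k < 2 ^ j)%N ->
  (forall x y, I0 x -> I0 y -> 0 <= (g x - g y) * (h x - h y)) ->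
  2 ^+ j * ((\int[mu]_(x in dyadic R j k) g x) *
            (\int[mu]_(x in dyadic R j k) h x)) <=
  \int[mu]_(x in dyadic R j k) (g x * h x).
Proof.
move=> gL hL kj co; have p : (0 : R) < 2 ^+ j by rewrite exprn_gt0.
rewrite -ler_pdivlMl//.
rewrite (_ : (2 ^+ j)^-1 = fine (mu (dyadic R j k))); last by rewrite mu_dyadic.
apply: comonotone_cov; [exact: measurable_dyadic|exact: mu_dyadic_lty|..].
- exact: (integrable_dyadic kj (L2_integrable gL)).
- exact: (integrable_dyadic kj (L2_integrable hL)).
- exact: (integrable_dyadic kj (L2_mul gL hL)).
- by move=> x y /(dyadic_sub_I0 kj) Ix /(dyadic_sub_I0 kj) Iy; exact: co.
Qed.

(** Bessel's inequality for the projection, as the covariance of [f] with itself. *)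
Lemma oscillation_ge0 f j : is_L2 f -> 0 <= oscillation j f.
Proof.
move=> fL; rewrite oscillationE//; apply: sumr_ge0 => k _.
rewrite subr_ge0; apply: comonotone_cov_dyadic => // x y _ _.
exact: sqr_ge0.
Qed.

(** The defect is twice the sum over the dyadic intervals of the covariances of [g]
    and [h]. *)
Lemma oscillation_superadd g h j : is_L2 g -> is_L2 h ->
  (forall x y, I0 x -> I0 y -> 0 <= (g x - g y) * (h x - h y)) ->
  oscillation j g + oscillation j h <= oscillation j (fun x => g x + h x).
Proof.
move=> gL hL co; rewrite !oscillationE//; last exact: L2_add.
rewrite -big_split/=; apply: ler_sum => k _.
have := comonotone_cov_dyadic gL hL (ltn_ord k) co.
have kj := ltn_ord k; have mD := measurable_dyadic j k.
have ig := integrable_dyadic kj (L2_integrable gL).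
have ih := integrable_dyadic kj (L2_integrable hL).
have ig2 := integrable_dyadic kj (L2_sqr gL).
have ih2 := integrable_dyadic kj (L2_sqr hL).
have igh := integrable_dyadic kj (L2_mul gL hL).
have i1 : mu.-integrable (dyadic R j k) (EFin \o (fun x => 2 * (g x * h x))).
  exact: (integrableZl mD 2 igh).
have i2 : mu.-integrable (dyadic R j k)
    (EFin \o (fun x => 2 * (g x * h x) + h x ^+ 2)).
  exact: (integrableD mD i1 ih2).
have -> : \int[mu]_(x in dyadic R j k) ((g x + h x) ^+ 2) =
    \int[mu]_(x in dyadic R j k) (g x ^+ 2) +
    (2 * \int[mu]_(x in dyadic R j k) (g x * h x) +
    \int[mu]_(x in dyadic R j k) (h x ^+ 2)).
  rewrite -RintegralZl// -!RintegralD//.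
  by apply: eq_Rintegral => x _; ring.
rewrite RintegralD//.
move: (Rintegral _ _ _) (Rintegral _ _ _) (Rintegral _ _ _) => a b c.
move: (Rintegral _ _ _) (Rintegral _ _ _) => d e.
by nra.
Qed.

Lemma proj_sqnorm_homo f : is_L2 f ->
  {homo proj_sqnorm^~ f : i j / (i <= j)%N >-> i <= j}.
Proof.
move=> fL; apply: homo_leq => [//|x y z|j]; first exact: le_trans.
by rewrite -subr_ge0 -haar_level// sumr_ge0// => k _; rewrite sqr_ge0.
Qed.
(** * Completeness of the dyadic averages *)

(** The dyadic interval of length [2 ^- n] that contains [x], for every real [x]:
    differentiation along shrinking sets needs a family defined on the whole line. *)
Definition dyadic_cell (x : R) n : set R :=
  [set` `[2 ^- n * (Num.floor (2 ^+ n * x))%:~R,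
          2 ^- n * (Num.floor (2 ^+ n * x) + 1)%:~R[].

(** The cell has half the length of the ball of radius [2 ^- n] around [x] that
    contains it. *)
Lemma nicely_shrinking_dyadic_cell (x : R) : nicely_shrinking x (dyadic_cell x).
Proof.
split=> [n|]; first exact: measurable_itv.
have p n : (0 : R) < 2 ^- n by rewrite invr_gt0 exprn_gt0.
exists (2, fun n => PosNum (p n)); split => //=.
- have := @cvg_geometric R 1 2^-1 _.
  rewrite ger0_norm// invf_lt1// ltr1n => /(_ isT).
  by apply: cvg_trans; apply: near_eq_cvg; near=> n; rewrite /= mul1r exprVn.
- move=> n y; rewrite /dyadic_cell /= in_itv/= => /andP[ly yr].
  have /andP[lx xr] := floor_itv (2 ^+ n * x).
  move: lx xr; rewrite -[_ <= _ * _](ler_pM2l (p n)) -[_ * _ < _](ltr_pM2l (p n)).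
  rewrite mulKf ?expf_neq0// => lx xr.
  rewrite /ball/= ltr_norml; move: yr xr; rewrite intrD mulrDr mulr1 => yr xr.
  by apply/andP; split; lra.
- move=> n; rewrite lebesgue_measure_ball ?(ltW (p n))//.
  rewrite /dyadic_cell lebesgue_measure_itv/= lte_fin ltr_pM2l// ltr_int.
  rewrite ltrDl ltr01 -EFinB -mulrBr -intrB addrAC subrr add0r mulr1.
  by rewrite -EFinM lee_fin mulr_natl.
Unshelve. all: by end_near. Qed.

Lemma dyadic_cellE (x : R) n k : dyadic R n k x -> dyadic_cell x n = dyadic R n k.
Proof.
rewrite /dyadic /dyadic_cell /= in_itv/= => /andP[lx xr].
rewrite (@floor_def _ _ (Posz k)) ?intrD ?natr1//.
have p : (0 : R) < 2 ^- n by rewrite invr_gt0 exprn_gt0.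
rewrite -(ler_pM2l p) -[_ < k.+1%:R](ltr_pM2l p) mulKf ?expf_neq0//.
by rewrite lx.
Qed.

Lemma in_dyadic (x : R) n : dyadic R 0 0 x ->
  exists2 k : 'I_(2 ^ n), dyadic R n k x &
    forall i : 'I_(2 ^ n), dyadic R n i x -> i = k.
Proof.
rewrite /dyadic /= !in_itv/= expr0 invr1 !mul1r => /andP[x0 x1].
have p : (0 : R) < 2 ^+ n by rewrite exprn_gt0.
have tx := truncn_itv (mulr_ge0 (ltW p) x0).
have kn : (Num.trunc (2 ^+ n * x) < 2 ^ n)%N.
  rewrite -(ltr_nat R); case/andP : tx => /le_lt_trans + _; apply.
  by rewrite natrX -[ltRHS]mulr1 ltr_pM2l.
exists (Ordinal kn) => /=.
  by rewrite in_itv/= ler_pdivrMl// ltr_pdivlMl.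
move=> i; rewrite in_itv/= ler_pdivrMl// ltr_pdivlMl// => ix; apply: val_inj => /=.
by symmetry; apply: truncn_def.
Qed.

(** The square of the projection of [f] onto the functions constant on the dyadic
    intervals of generation [n]; the intervals being disjoint, no cross terms
    appear. *)
Definition mean_sqr n f (x : R) : R :=
  \sum_(k < 2 ^ n)
    (2 ^+ n * \int[mu]_(y in dyadic R n k) f y) ^+ 2 * \1_(dyadic R n k) x.

Lemma measurable_mean_sqr n f (D : set RT) : @measurable_fun _ _ RT R D (mean_sqr n f).
Proof.
apply: measurable_sum => k; apply: measurable_funM => //.
by apply: measurable_indic; exact: measurable_dyadic.
Qed.

Lemma mean_sqr_ge0 n f (x : R) : 0 <= mean_sqr n f x.
Proof. by apply: sumr_ge0 => k _; rewrite mulr_ge0 ?sqr_ge0. Qed.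

Lemma integral_mean_sqr n f : is_L2 f ->
  (\int[mu]_(x in dyadic R 0 0) (mean_sqr n f x)%:E = (proj_sqnorm n f)%:E)%E.
Proof.
move=> fL; rewrite /mean_sqr.
under eq_integral do rewrite -sumEFin.
rewrite ge0_integral_sum//; last 3 first.
- exact: measurable_dyadic.
- move=> k; apply/measurable_EFinP; apply: measurable_funM => //.
  by apply: measurable_indic; exact: measurable_dyadic.
- by move=> k x _; rewrite lee_fin mulr_ge0 ?sqr_ge0.
rewrite /proj_sqnorm -sumEFin; apply: eq_bigr => k _.
under eq_integral do rewrite EFinM.
rewrite ge0_integralZl//; last 3 first.
- exact: measurable_dyadic.
- by apply/measurable_EFinP; apply: measurable_indic; exact: measurable_dyadic.
- by rewrite lee_fin sqr_ge0.
rewrite integral_indic//; [|exact: measurable_dyadic|exact: measurable_dyadic].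
rewrite setIidl; last first.
  move=> x xk; suff -> : dyadic R 0 0 = [set` `[0, 1[].
    move: (dyadic_sub_I0 (ltn_ord k) xk); rewrite /I0 /= !in_itv/= => /andP[-> _] /=.
    move: xk; rewrite /dyadic /= in_itv/= => /andP[_ /lt_le_trans]; apply.
    by rewrite ler_pdivrMl ?exprn_gt0// mulr1 -natrX ler_nat.
  by rewrite /dyadic expr0 invr1 !mul1r.
rewrite [X in (_ * X)%E](mu_dyadic n k) -EFinM; congr EFin.
by field; rewrite expf_neq0.
Qed.

(** Lebesgue's differentiation theorem along the dyadic cells. *)
Lemma mean_sqr_cvg f : is_L2 f ->
  {ae mu, forall x, dyadic R 0 0 x ->
    (mean_sqr n f x)%:E @[n --> \oo] --> (f x ^+ 2)%:E}.
Proof.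
move=> fL; have locF := integrable_locally_restrict measurable_I0 (L2_integrable fL).
have := lebesgue_differentiation locF.
apply: filterS; first exact: (ae_filter_ringOfSetsType mu).
move=> x xpt Dx.
have := nice_lebesgue_differentiation nicely_shrinking_dyadic_cell locF xpt.
have Ix : I0 x by exact: dyadic_sub_I0 Dx.
rewrite patchE mem_set// => /fine_cvg fc.
apply: cvg_EFin; first by near=> n.
rewrite /comp/=.
have -> : (fun n => mean_sqr n f x) =
   (fun n => (fine ((mu (dyadic_cell x n))^-1 *
      \int[mu]_(y in dyadic_cell x n) ((f \_ I0) y)%:E)%E) ^+ 2).
  apply/funext => n; have [k xk uk] := in_dyadic n Dx.
  rewrite (dyadic_cellE xk) mu_dyadic /mean_sqr (bigD1 k)//= big1 ?addr0.
    rewrite indicE mem_set// mulr1; congr (_ ^+ 2).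
    have -> : (\int[mu]_(y in dyadic R n k) ((f \_ I0) y)%:E =
        (\int[mu]_(y in dyadic R n k) f y)%:E)%E.
      rewrite /Rintegral fineK; last first.
        apply: integrable_fin_num; first exact: measurable_dyadic.
        exact: integrable_dyadic (L2_integrable fL).
      apply: eq_integral => y; rewrite inE => yk.
      by rewrite patchE mem_set//; exact: dyadic_sub_I0 yk.
    by rewrite inver gt_eqF ?invr_gt0 ?exprn_gt0//= invrK.
  move=> i ik; rewrite indicE memNset ?mulr0// => xi.
  by move: ik; rewrite (uk i xi) eqxx.
exact: (cvgM fc fc).
Unshelve. all: by end_near. Qed.

(** Completeness of the Haar system: together with Bessel's inequality it says that
    the integral of [f ^ 2] is the supremum of the [proj_sqnorm j f]. Fatou's lemma
    suffices, since only this direction needs an argument. *)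
Lemma sqnorm_le_proj f (B : R) : is_L2 f ->
  (forall j, proj_sqnorm j f <= B) -> \int[mu]_(x in I0) (f x ^+ 2) <= B.
Proof.
move=> fL mB; have mD := measurable_dyadic 0 0 : @measurable _ RT (dyadic R 0 0).
rewrite (Rintegral_dyadic 0 (L2_sqr fL)) big_ord_recr big_ord0 /= add0r.
have f2 := integrable_dyadic (isT : (0 < 2 ^ 0)%N) (L2_sqr fL).
rewrite -lee_fin /Rintegral fineK; last exact: integrable_fin_num.
have mms n : measurable_fun (dyadic R 0 0 : set RT) (fun x => (mean_sqr n f x)%:E).
  by apply/measurable_EFinP; exact: measurable_mean_sqr.
apply: (@le_trans _ _
  (\int[mu]_(x in dyadic R 0 0) limn_einf (fun n => (mean_sqr n f x)%:E))%E).
- apply: ae_ge0_le_integral => //.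
  + by move=> x _; rewrite lee_fin sqr_ge0.
  + exact: measurable_int f2.
  + move=> x _; rewrite limn_einf_lim; apply: lime_ge; first exact: is_cvg_einfs.
    near=> n; apply: le_ereal_inf_tmp => _ [m _ <-].
    by rewrite lee_fin mean_sqr_ge0.
  + apply: (emeasurable_fun_cvg
      (fun n x => einfs (fun m => (mean_sqr m f x)%:E) n)) => [n|x _].
      exact: (measurable_fun_einfs mms n).
    by rewrite limn_einf_lim; exact: is_cvg_einfs.
  + have := mean_sqr_cvg fL; apply: filterS.
      exact: (ae_filter_ringOfSetsType mu).
    move=> x cx Dx.
    by rewrite (cvg_limn_einf_sup (cx Dx)).1.
apply: (le_trans (fatou _ _ _ _)) => //.
  by move=> n x _; rewrite lee_fin mean_sqr_ge0.
rewrite limn_einf_lim; apply: lime_le; first exact: is_cvg_einfs.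
near=> n; apply: (@le_trans _ _ (\int[mu]_(x in dyadic R 0 0) (mean_sqr n f x)%:E)%E).
  by apply: ereal_inf_lbound; exists n => //=.
by rewrite integral_mean_sqr// lee_fin.
Unshelve. all: by end_near. Qed.
(** * The Sobolev energy as a weighted sum of oscillations *)

(** The increments of [j |-> |I|^(-2s)], where [|I| = 2 ^- j], with the convention
    that the value before [j = 0] is zero; they are the coefficients that
    summation by parts puts in front of the oscillations. *)
Definition osc_weight s j : R :=
  if j is i.+1 then (2 `^ (2 * s)) ^+ i.+1 - (2 `^ (2 * s)) ^+ i else 1.

Lemma dlen_powR s j : dlen R j `^ (- (2 * s)) = (2 `^ (2 * s)) ^+ j.
Proof.
rewrite /dlen -powR_invn// -powRrM mulrNN -powR_mulrn ?powR_ge0// -powRrM.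
by rewrite (mulrC j%:R).
Qed.

Lemma osc_weight_ge0 s j : 0 <= s -> 0 <= osc_weight s j.
Proof.
move=> s0; case: j => [|i] //=.
have l1 : 1 <= 2 `^ (2 * s) :> R.
  by rewrite -[leLHS](powRr0 2) ler_powR ?ler1n// mulr_ge0.
by rewrite subr_ge0 ler_weXn2l.
Qed.

Lemma sum_osc_weight s n :
  \sum_(j < n.+1) osc_weight s j = (2 `^ (2 * s)) ^+ n.
Proof.
elim: n => [|n IH]; first by rewrite big_ord_recr big_ord0 /= add0r expr0.
by rewrite big_ord_recr IH /= addrC subrK.
Qed.

(** Summation by parts, arranged so that the right-hand side involves the
    differences to the last term [m n]; in the application these increase to the
    oscillations as [n] grows. *)
Lemma sum_by_parts s (m : nat -> R) n :
  \sum_(j < n) (2 `^ (2 * s)) ^+ j * (m j.+1 - m j) =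
  \sum_(j < n) osc_weight s j * (m n - m j).
Proof.
elim: n => [|n IH]; first by rewrite !big_ord0.
rewrite big_ord_recr /= IH -sum_osc_weight mulr_suml !big_ord_recr /=.
rewrite addrA -big_split/=; congr (_ + _).
by apply: eq_bigr => j _; rewrite -mulrDr addrC addrA subrK.
Qed.

(** Haar coefficients are traded for oscillations, which behave well under
    composition with monotone functions. For the partial sums, summation by parts
    gives oscillations with [m n] in place of the integral of [f ^ 2]: they are
    bounded by Bessel's inequality in one direction, and in the other one a fixed
    number [N] of terms is kept while [n] tends to infinity. *)
Lemma sqnorm_DE s f : 0 <= s -> is_L2 f ->
  (sqnorm_D s f = \sum_(0 <= j <oo) (osc_weight s j * oscillation j f)%:E)%E.
Proof.
move=> s0 fL.
set lam : R := 2 `^ (2 * s).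
pose m j := proj_sqnorm j f.
have lam0 n : 0 < lam ^+ n by rewrite exprn_gt0// powR_gt0.
have -> : (sqnorm_D s f = \sum_(0 <= j <oo) (lam ^+ j * (m j.+1 - m j))%:E)%E.
  apply: eq_eseriesr => j _; congr EFin.
  by rewrite -mulr_sumr dlen_powR haar_level.
have L0 j : (0 <= (lam ^+ j * (m j.+1 - m j))%:E)%E.
  by rewrite lee_fin mulr_ge0 ?(ltW (lam0 _))// subr_ge0 proj_sqnorm_homo.
have W0 j : (0 <= (osc_weight s j * oscillation j f)%:E)%E.
  by rewrite lee_fin mulr_ge0 ?osc_weight_ge0 ?oscillation_ge0.
have partial n : (\sum_(0 <= j < n) (lam ^+ j * (m j.+1 - m j))%:E =
    (\sum_(j < n) osc_weight s j * (m n - m j))%:E)%E.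
  by rewrite sumEFin big_mkord sum_by_parts.
apply/eqP; rewrite eq_le; apply/andP; split.
- apply: lime_le; first exact: is_cvg_nneseries.
  near=> n; rewrite partial; apply: le_trans (nneseries_lim_ge n _) => //.
  rewrite sumEFin big_mkord lee_fin; apply: ler_sum => j _.
  rewrite ler_wpM2l ?osc_weight_ge0// lerD2r.
  by have := oscillation_ge0 n fL; rewrite subr_ge0.
- apply: lime_le; first exact: is_cvg_nneseries.
  near=> N; rewrite sumEFin big_mkord.
  set S := (limn _).
  have Sge n : ((\sum_(j < n) osc_weight s j * (m n - m j))%:E <= S)%E.
    by rewrite -partial; exact: nneseries_lim_ge.
  have : (0 <= S)%E by exact: nneseries_ge0.
  case: S Sge => [d Sge d0 | _ _ | //]; last by rewrite leey.
  case: (posnP N) => [->|Npos]; first by rewrite big_ord0.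
  have wpos : 0 < \sum_(j < N) osc_weight s j.
    by rewrite -(prednK Npos) sum_osc_weight.
  (* The first [N] terms bound a multiple of [m M], uniformly in [M]; so
     completeness applies to the bound solved for [m M]. *)
  have : \int[mu]_(x in I0) (f x ^+ 2) <=
      (d + \sum_(j < N) osc_weight s j * m j) / \sum_(j < N) osc_weight s j.
    apply: sqnorm_le_proj => // M.
    apply: (@le_trans _ _ (m (maxn M N))).
      by apply: proj_sqnorm_homo => //; exact: leq_maxl.
    rewrite ler_pdivlMr// mulr_sumr -lerBlDr -sumrB.
    rewrite -lee_fin; apply: le_trans (Sge (maxn M N)).
    rewrite lee_fin.
    have NK := leq_maxr M N.
    rewrite -[leRHS](big_mkord xpredT (fun j => osc_weight s j * (m (maxn M N) - m j))).
    rewrite (big_cat_nat (leq0n N) NK)//= big_mkord.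
    rewrite -[leLHS]addr0; apply: lerD.
      by rewrite le_eqVlt; apply/orP; left; apply/eqP; apply: eq_bigr => j _; ring.
    rewrite big_nat_cond; apply: sumr_ge0 => j /andP[/andP[_ jK] _].
    rewrite mulr_ge0 ?osc_weight_ge0// subr_ge0.
    by apply: proj_sqnorm_homo => //; exact: ltnW.
  rewrite ler_pdivlMr// mulr_sumr -lerBlDr -sumrB lee_fin; apply: le_trans.
  by rewrite le_eqVlt; apply/orP; left; apply/eqP; apply: eq_bigr => j _;
    rewrite /oscillation /m; ring.
Unshelve. all: by end_near. Qed.

Lemma sqnorm_D_ge0 s f : (0 <= sqnorm_D s f)%E.
Proof.
apply: nneseries_ge0 => j _ _; rewrite lee_fin sumr_ge0// => k _.
by rewrite mulr_ge0 ?powR_ge0 ?sqr_ge0.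
Qed.

Lemma sqnorm_L2_ge0 f : (0 <= sqnorm_L2 f)%E.
Proof. by apply: integral_ge0 => x _; rewrite lee_fin sqr_ge0. Qed.

Lemma sqnorm_H_ge0 s f : (0 <= sqnorm_H s f)%E.
Proof. by rewrite adde_ge0 ?sqnorm_D_ge0 ?sqnorm_L2_ge0. Qed.

(** This replaces the orthogonality of the pieces, which fails for the slices of a
    function: variances of comonotone functions are superadditive at every scale,
    and so are squares of functions of the same sign. *)
Lemma sqnorm_H_superadd s g h : 0 <= s -> is_L2 g -> is_L2 h ->
  (forall x y, I0 x -> I0 y -> 0 <= (g x - g y) * (h x - h y)) ->
  (forall x, I0 x -> 0 <= g x * h x) ->
  (sqnorm_H s g + sqnorm_H s h <= sqnorm_H s (fun x => (g x + h x)%R))%E.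
Proof.
move=> s0 gL hL co gh0; have ghL := L2_add gL hL.
rewrite /sqnorm_H addeACA; apply: leeD.
  rewrite !sqnorm_DE// -nneseriesD; last 2 first.
  - by move=> i _ _; rewrite lee_fin mulr_ge0 ?osc_weight_ge0 ?oscillation_ge0.
  - by move=> i _ _; rewrite lee_fin mulr_ge0 ?osc_weight_ge0 ?oscillation_ge0.
  apply: lee_nneseries => i _.
    by rewrite adde_ge0// lee_fin mulr_ge0 ?osc_weight_ge0 ?oscillation_ge0.
  rewrite -EFinD lee_fin -mulrDr ler_wpM2l ?osc_weight_ge0//.
  exact: oscillation_superadd.
have mI := measurable_I0.
rewrite !sqnorm_L2E// -EFinD lee_fin -RintegralD//; last 2 first.
- exact: L2_sqr.
- exact: L2_sqr.
apply: le_Rintegral => //.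
- exact: (integrableD mI (L2_sqr gL) (L2_sqr hL)).
- exact: L2_sqr.
- by move=> x /gh0; rewrite sqrrD; lra.
Qed.

Lemma oscillation_scale f j (r : R) : is_L2 f ->
  oscillation j (fun x => r * f x) = r ^+ 2 * oscillation j f.
Proof.
move=> fL; have mI := measurable_I0; have mD k := measurable_dyadic j k.
rewrite /oscillation mulrBr -RintegralZl//; last exact: L2_sqr.
congr (_ - _); first by apply: eq_Rintegral => x _; rewrite exprMn.
rewrite /proj_sqnorm mulr_sumr; apply: eq_bigr => k _.
rewrite RintegralZl//; last exact: integrable_dyadic (L2_integrable fL).
by rewrite exprMn; ring.
Qed.

Lemma sqnorm_H_scale s f (r : R) : 0 <= s -> is_L2 f ->
  (sqnorm_H s (fun x => r * f x)%R = (r ^+ 2)%:E * sqnorm_H s f)%E.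
Proof.
move=> s0 fL; have rL := L2_scale r fL; have mI := measurable_I0.
rewrite /sqnorm_H ge0_muleDr ?sqnorm_D_ge0 ?sqnorm_L2_ge0//; congr (_ + _)%E.
  rewrite !sqnorm_DE// -nneseriesZl; last first.
    by move=> i _; rewrite lee_fin mulr_ge0 ?osc_weight_ge0 ?oscillation_ge0.
  apply: eq_eseriesr => j _; rewrite -EFinM oscillation_scale//; congr EFin.
  by ring.
rewrite !sqnorm_L2E// -EFinM -RintegralZl//; last exact: L2_sqr.
by congr EFin; apply: eq_Rintegral => x _; rewrite exprMn.
Qed.
(** * Truncations and capacity *)

Definition clip (c u : R) : R := Num.min (Num.max u 0) c.

Lemma clip_ge0 c u : 0 <= c -> 0 <= clip c u.
Proof. by move=> c0; rewrite /clip le_min c0 le_max lexx orbT. Qed.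

Lemma clip_increment_ge0 a b u : a <= b -> 0 <= clip b u - clip a u.
Proof. by move=> ab; rewrite subr_ge0 /clip le_min !ge_min lexx ab orbT. Qed.

Lemma le_clip c u v : u <= v -> clip c u <= clip c v.
Proof.
by move=> uv; rewrite /clip le_min2// le_max2.
Qed.

Lemma le_clip_increment a b u v : 0 <= a -> a <= b -> u <= v ->
  clip b u - clip a u <= clip b v - clip a v.
Proof.
move=> a0 ab uv; rewrite /clip.
case: (leP u 0) => u0; case: (leP v 0) => v0; rewrite ?minEle;
  repeat case: ifPn => *; lra.
Qed.

Lemma le_clip_rest c u v : 0 <= c -> u <= v -> u - clip c u <= v - clip c v.
Proof.
move=> a0 uv; rewrite /clip.
case: (leP u 0) => u0; case: (leP v 0) => v0; rewrite ?minEle;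
  repeat case: ifPn => *; lra.
Qed.

Lemma clip_rest_ge0 c u : 0 <= c -> 0 <= clip c u * (u - clip c u).
Proof.
move=> c0; rewrite /clip; case: (leP u 0) => u0; rewrite minEle; case: ifPn => h;
  rewrite ?mul0r//; [nra|nra|]; rewrite mulr_ge0//; lra.
Qed.

(** The slice is saturated above its upper height; this is what makes it
    admissible for a superlevel set. *)
Lemma clip_incrementE b u : 0 <= b -> 2 * b <= u ->
  clip (2 * b) u - clip b u = b.
Proof. by move=> b0 bu; rewrite /clip max_l ?min_r; lra. Qed.

Lemma normr_clip_le c u : 0 <= c -> `|clip c u| <= `|u|.
Proof.
move=> c0; rewrite ger0_norm ?clip_ge0// /clip ge_min ge_max ler_norm.
by rewrite normr_ge0.
Qed.

Lemma homo_mul_ge0 (p q : R -> R) u v :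
  {homo p : x y / x <= y} -> {homo q : x y / x <= y} ->
  0 <= (p u - p v) * (q u - q v).
Proof.
move=> hp hq; have [uv|/ltW vu] := leP u v.
  by rewrite mulr_le0// subr_le0 ?hp ?hq.
by rewrite mulr_ge0// subr_ge0 ?hp ?hq.
Qed.

Lemma L2_clip f (c : R) : 0 <= c -> is_L2 f -> is_L2 (clip c \o f).
Proof.
move=> c0 fL; have mmax : @measurable_fun _ _ RT R I0 (f \max cst 0).
  by apply: measurable_maxr; [exact: L2_measurable|exact: measurable_cst].
apply: (L2_le (measurable_minr mmax (measurable_cst c)) fL) => x _.
exact: normr_clip_le.
Qed.

Lemma L2_sub g h : is_L2 g -> is_L2 h -> is_L2 (fun x => g x - h x).
Proof.
move=> gL hL; have := L2_add gL (L2_scale (-1) hL).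
by under eq_fun do rewrite mulN1r.
Qed.

(** Both [clip c f] and the remainder [f - clip c f] are nondecreasing functions of
    [f] with a nonnegative product. *)
Lemma sqnorm_H_clip s f c : 0 <= s -> 0 <= c -> is_L2 f ->
  (sqnorm_H s (clip c \o f) <= sqnorm_H s f)%E.
Proof.
move=> s0 c0 fL; have cL := L2_clip c0 fL; have dL := L2_sub fL cL.
have {2}-> : f = (fun x => (clip c \o f) x + (f x - (clip c \o f) x)).
  by apply/funext => x; rewrite addrC subrK.
apply: le_trans (sqnorm_H_superadd s0 cL dL _ _).
- by rewrite leeDl// sqnorm_H_ge0.
- move=> x y _ _; apply: (homo_mul_ge0 (p := clip c) (q := fun u => u - clip c u)).
    by move=> u v; exact: le_clip.
  by move=> u v; exact: le_clip_rest.
- by move=> x _; exact: clip_rest_ge0.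
Qed.

(** The slices are stacked one at a time: [clip (c n) f] and the next slice are
    comonotone and nonnegative, with sum [clip (c n.+1) f]. *)
Lemma sum_sqnorm_H_clip s f (c : nat -> R) n : 0 <= s -> is_L2 f ->
  (forall j, 0 <= c j) -> (forall j, c j <= c j.+1) ->
  (\sum_(j < n) sqnorm_H s (fun x => clip (c j.+1) (f x) - clip (c j) (f x))%R
    <= sqnorm_H s f)%E.
Proof.
move=> s0 fL c0 cS.
suff H : (\sum_(j < n) sqnorm_H s (fun x => clip (c j.+1) (f x) - clip (c j) (f x))%R
    <= sqnorm_H s (clip (c n) \o f))%E.
  by apply: le_trans H _; exact: sqnorm_H_clip.
elim: n => [|n IH]; first by rewrite big_ord0 sqnorm_H_ge0.
rewrite big_ord_recr /=; rewrite addeC; apply: le_trans (leeD2l _ IH) _; rewrite addeC.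
have aL := L2_clip (c0 n) fL; have bL := L2_clip (c0 n.+1) fL.
have dL := L2_sub bL aL.
have -> : clip (c n.+1) \o f = (fun x => (clip (c n) \o f) x +
    ((clip (c n.+1) \o f) x - (clip (c n) \o f) x)).
  by apply/funext => x; rewrite addrC subrK.
apply: sqnorm_H_superadd => //.
- move=> x y _ _; apply: (homo_mul_ge0 (p := clip (c n))
    (q := fun u => clip (c n.+1) u - clip (c n) u)).
    by move=> u v; exact: le_clip.
  by move=> u v; exact: le_clip_increment.
- by move=> x _; rewrite mulr_ge0 ?clip_ge0 ?clip_increment_ge0.
Qed.

Lemma Cap_ge0 s (E : set R) : (0 <= Cap s E)%E.
Proof. by apply: le_ereal_inf_tmp => _ [f _ <-]; exact: sqnorm_H_ge0. Qed.

Lemma le_Cap s (E F : set R) : E `<=` F -> (Cap s E <= Cap s F)%E.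
Proof.
move=> EF; apply: ereal_inf_le_tmp => _ [f [Hf aef] <-]; exists f => //; split => //.
move: aef; apply: filterS; first exact: (ae_filter_ringOfSetsType mu).
by move=> x Fx /EF; exact: Fx.
Qed.

(** The capacitary weak-type inequality, from the competitor [f / t]. *)
Lemma Cap_chebyshev s f (E : set R) t : 0 <= s -> 0 < t -> is_L2 f ->
  (forall x, E x -> t <= f x) -> ((t ^+ 2)%:E * Cap s E <= sqnorm_H s f)%E.
Proof.
move=> s0 t0 fL Ef; have [foo|] := ltP (sqnorm_H s f) +oo%E; last first.
  by rewrite leye_eq => /eqP ->; rewrite leey.
have t2 : 0 < (t ^+ 2)^-1 by rewrite invr_gt0 exprn_gt0.
rewrite -[(t ^+ 2)]invrK lee_pdivrMl// -exprVn -sqnorm_H_scale//.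
apply: ereal_inf_lbound; exists (fun x => t^-1 * f x) => //; split.
  split; first exact: L2_scale.
  by rewrite sqnorm_H_scale// lte_mul_pinfty// ?lee_fin ?sqr_ge0.
apply: aeW => x /Ef; by rewrite ler_pdivlMl// mulr1.
Qed.

(** The superlevel sets of a monotone function are intervals. *)
Lemma measurable_nonincreasing (u : R -> \bar R) (D : set RT) :
  {homo u : x y / x <= y >-> (y <= x)%E} -> @measurable_fun _ _ RT _ D u.
Proof.
move=> hu; apply: (@measurable_funS _ _ RT _ setT) => //.
move=> mT; apply: (measurability _ (ErealGenCInfty.measurableE R)) => //.
move=> _ [_ [r ->] <-]; rewrite setTI; apply: is_interval_measurable.
move=> x y /=; rewrite !in_itv/= !andbT => rx ry z /andP[xz zy].
by rewrite in_itv/= andbT (le_trans ry)// hu.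
Qed.

Definition superlevel f t : set R := [set x | I0 x /\ t <= f x].

Lemma Cap_superlevel_nonincreasing s f :
  {homo (fun t => Cap s (superlevel f t)) : x y / x <= y >-> (y <= x)%E}.
Proof.
by move=> t u tu; apply: le_Cap => x [Ix ux]; split => //; exact: le_trans ux.
Qed.

Lemma measurable_Cap_superlevel s f (D : set RT) :
  @measurable_fun _ _ RT _ D (fun t => (t%:E * Cap s (superlevel f t))%E).
Proof.
apply: emeasurable_funM; first by apply/measurable_EFinP; exact: measurable_id.
apply: measurable_nonincreasing; exact: Cap_superlevel_nonincreasing.
Qed.

(** With [c = 2 * b], the integrand is at most [2 * c * Cap {f >= c}] on an interval
    of length [c], and [b ^ 2 * Cap {f >= c}] is at most the squared norm of the
    slice of [f] between [b] and [c]; the constant is [2 * c ^ 2 / b ^ 2 = 8]. *)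
Lemma integral_Cap_octave s f (b : R) : 0 <= s -> 0 < b -> is_L2 f ->
  (\int[mu]_(t in [set` `[(2 * b)%R, (2 * (2 * b))%R[])
      (t%:E * Cap s (superlevel f t))
   <= 8%:E * sqnorm_H s (fun x => clip (2 * b) (f x) - clip b (f x))%R)%E.
Proof.
move=> s0 b0 fL; pose c := 2 * b.
have c0 : 0 < c by rewrite mulr_gt0.
have mI : @measurable _ RT [set` `[c, 2 * c[] by exact: measurable_itv.
apply: (@le_trans _ _ (\int[mu]_(t in [set` `[c, (2 * c)%R[])
   ((2 * c)%:E * Cap s (superlevel f c)))%E).
  apply: ge0_le_integral => //.
  - move=> t; rewrite /= in_itv/= => /andP[ct _].
    by rewrite mule_ge0 ?Cap_ge0// lee_fin (le_trans (ltW c0)).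
  - exact: measurable_Cap_superlevel.
  - move=> t; rewrite /= in_itv/= => /andP[ct tc].
    rewrite lee_pmul ?Cap_ge0 ?lee_fin ?(ltW tc)//.
      by rewrite (le_trans (ltW c0)).
    exact: Cap_superlevel_nonincreasing.
have muI : mu [set` `[c, 2 * c[] = c%:E.
  rewrite lebesgue_measure_itv/= lte_fin ifT; last by lra.
  by rewrite -EFinB; congr EFin; ring.
rewrite integral_cst// [X in (_ * X)%E]muI.
have bL := L2_clip (ltW b0) fL; have cL := L2_clip (ltW c0) fL.
have := @Cap_chebyshev s _ (superlevel f c) b s0 b0 (L2_sub cL bL) _.
move=> /(_ _)/(lee_wpmul2l (_ : 0 <= 8%:E)%E).
move=> H; apply: le_trans (H _ _).
- rewrite muleAC -EFinM muleA -EFinM le_eqVlt; apply/orP; left; apply/eqP.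
  by congr (_%:E * _)%E; rewrite /c; ring.
- by rewrite lee_fin.
- by move=> x [_ cx] /=; rewrite clip_incrementE ?(ltW b0).
Qed.

(** The octaves are consecutive, and each is charged to a different slice. *)
Lemma integral_Cap_octaves s f (b : R) n : 0 <= s -> 0 < b -> is_L2 f ->
  (\int[mu]_(t in [set` `[(2 * b)%R, (2 ^+ n * (2 * b))%R[])
      (t%:E * Cap s (superlevel f t))
   <= 8%:E * \sum_(j < n)
       sqnorm_H s (fun x => clip (2 ^+ j.+1 * b) (f x) - clip (2 ^+ j * b) (f x))%R)%E.
Proof.
move=> s0 b0 fL; elim: n => [|n IH].
  by rewrite big_ord0 mule0 expr0 mul1r set_itvco0 integral_set0.
have p1 : (1 : R) <= 2 ^+ n by rewrite exprn_ege1// ler1n.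
have -> : [set` `[2 * b, 2 ^+ n.+1 * (2 * b)[] =
    [set` `[2 * b, 2 ^+ n * (2 * b)[] `|`
    [set` `[2 * (2 ^+ n * b), 2 * (2 * (2 ^+ n * b))[] :> set R.
  rewrite (_ : 2 ^+ n * (2 * b) = 2 * (2 ^+ n * b)); last by ring.
  rewrite (_ : 2 ^+ n.+1 * (2 * b) = 2 * (2 * (2 ^+ n * b))); last first.
    by rewrite exprS; ring.
  by rewrite -itv_bndbnd_setU// bnd_simp; nra.
rewrite ge0_integral_setU//; last 3 first.
- exact: measurable_Cap_superlevel.
- move=> t tI; rewrite mule_ge0 ?Cap_ge0// lee_fin.
  by case: tI; rewrite /= in_itv/= => /andP[tb _]; apply: le_trans tb; nra.
- apply/disj_setPS => x [] /=; rewrite !in_itv/= => /andP[_ x1] /andP[x2 _]; nra.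
rewrite big_ord_recr/= ge0_muleDr ?sqnorm_H_ge0//; last first.
  by apply: sume_ge0 => j _; exact: sqnorm_H_ge0.
apply: leeD => //.
rewrite exprS -mulrA; apply: integral_Cap_octave => //.
by rewrite mulr_gt0// exprn_gt0.
Qed.

Lemma integral_Cap_bounded s f n : 0 <= s -> is_L2 f ->
  (\int[mu]_(t in [set` `[(2 ^- n)%R, (2 ^+ n)%R[]) (t%:E * Cap s (superlevel f t))
   <= 8%:E * sqnorm_H s f)%E.
Proof.
move=> s0 fL.
(* The octaves start at [2 * b = 2 ^- n], and [n + n] of them reach [2 ^+ n]. *)
pose b : R := 2 ^- n.+1.
have b0 : 0 < b by rewrite invr_gt0 exprn_gt0.
have -> : 2 ^- n = 2 * b by rewrite /b exprS; field; rewrite expf_neq0.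
have -> : 2 ^+ n = 2 ^+ (n + n) * (2 * b).
  by rewrite /b exprS exprD; field; rewrite expf_neq0.
apply: (le_trans (integral_Cap_octaves _ s0 b0 fL)).
apply: lee_wpmul2l; first by rewrite lee_fin.
apply: (@sum_sqnorm_H_clip s f (fun j => 2 ^+ j * b)) => //.
  by move=> j; rewrite mulr_ge0 ?(ltW b0)// exprn_ge0.
by move=> j; rewrite ler_pM2r// ler_weXn2l// ler1n.
Qed.

Lemma bigcup_itv_pow2 :
  \bigcup_n [set` `[2 ^- n, 2 ^+ n[] = [set` `]0, +oo[] :> set R.
Proof.
apply/seteqP; split => [x [n _]|x] /=; rewrite !in_itv/= ?andbT.
  by move=> /andP[+ _]; apply: lt_le_trans; rewrite invr_gt0 exprn_gt0.
move=> x0.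
have big (y : R) : y < 2 ^+ (Num.trunc `|y|).+1.
  have /andP[_ h] := truncn_itv (normr_ge0 y).
  apply: (le_lt_trans (ler_norm y)); apply: lt_le_trans h _.
  by rewrite -natrX ler_nat ltnW// ltn_expl.
pose n := maxn (Num.trunc `|x|).+1 (Num.trunc `|x^-1|).+1.
have le2 i : (i <= n)%N -> (2 ^+ i : R) <= 2 ^+ n.
  by move=> ?; rewrite ler_weXn2l// ler1n.
exists n => //=; rewrite in_itv/=; apply/andP; split.
  rewrite -[leRHS]invrK lef_pV2 ?posrE ?exprn_gt0 ?invr_gt0//.
  by apply: le_trans (ltW (big _)) _; rewrite le2// leq_maxr.
by apply: lt_le_trans (big _) _; rewrite le2// leq_maxl.
Qed.

Lemma capacitary_strong_type s f : 0 <= s -> is_L2 f ->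
  (\int[mu]_(t in [set` `[0%R, +oo[]) (t%:E * Cap s (superlevel f t))
   <= 8%:E * sqnorm_H s f)%E.
Proof.
move=> s0 fL; rewrite -integral_itv_obnd_cbnd; last exact: measurable_Cap_superlevel.
rewrite -bigcup_itv_pow2.
pose F n : set RT := [set` `[2 ^- n, 2 ^+ n[].
have cv : (\int[mu]_(t in F n) (t%:E * Cap s (superlevel f t))%E)%E @[n --> \oo] -->
    (\int[mu]_(t in \bigcup_n F n) (t%:E * Cap s (superlevel f t))%E)%E.
  apply: ge0_nondecreasing_set_cvg_integral.
  - move=> m n mn; apply/subsetPset => t; rewrite /F /= !in_itv/= => /andP[a b].
    have mn2 : (2 ^+ m : R) <= 2 ^+ n by rewrite ler_weXn2l// ler1n.
    rewrite (lt_le_trans b mn2) andbT (le_trans _ a)//.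
    by rewrite lef_pV2 ?posrE ?exprn_gt0.
  - by move=> n; exact: measurable_itv.
  - by move=> n; exact: measurable_Cap_superlevel.
  - move=> n t; rewrite /F /= in_itv/= => /andP[tn _].
    by rewrite mule_ge0 ?Cap_ge0// lee_fin (le_trans _ tn)// invr_ge0 exprn_ge0.
rewrite -(cvg_lim _ cv)//.
by apply: lime_le; [exact: (cvgP _ cv)|near=> n; exact: integral_Cap_bounded].
Unshelve. all: by end_near. Qed.
End StrongTypeInequality.

Theorem proposition3p2 (R : realType) (s : R) (s_gt0 : 0 < s) (s_lt1 : s < 1) :
  exists C : R, 0 < C /\
    forall f : R -> R, is_H s f ->
      (\int[@lebesgue_measure R]_(t in [set` `[0%R : R, +oo[])
         (t%:E * Cap s [set x | I0 x /\ (t <= f x)%R])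
       <= C%:E * sqnorm_H s f)%E.
Proof.
exists 8; split => // f [fL _].
exact: capacitary_strong_type (ltW s_gt0) fL.
Qed.
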